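(* Fix $\gamma>0$ and $d\ge1$. Let $U(q)=\sum_{i=1}^dv(q_i)$ on $\mathbb{R}^d$, where $v(s)=\frac12(|s|-1)^2$ for $|s|\ge\frac12$ and $v(s)=\frac14-\frac12s^2$ for $|s|\le\frac12$. Then: (a) $U\in C^1(\mathbb{R}^d)$ and $\nabla U$ is $L$-Lipschitz with $L=1$. (b) For any $\lambda\in\left(0,\frac1{4+\gamma^2}\right]$, the dissipativity condition $$\frac12q\cdot\nabla U(q)\ge\lambda\left(U(q)+\frac{\gamma^2}{4}|q|^2\right)-A,\qquad q\in\mathbb{R}^d,$$ holds with $A:=d\,A_1(\gamma)$, $A_1(\gamma):=\frac{\gamma^4+6\gamma^2+16}{4(\gamma^4+10\gamma^2+24)}$ (the same $A$ for all such $\lambda$). (c) For any $|q|\ge\sqrt d$, $|\nabla U(q)-q|\le\varrho(|q|)\,|q|$ with $\varrho(r):=\sqrt d/r$, so that $\varrho(r)\to0$ as $r\to\infty$ for each fixed $d$. Consequently $U$ satisfies both the potential assumption and the asymptotically linear gradient assumption stated in the context (with $Q_\infty=I_d$ in the latter).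
   Context: $|\cdot|$ is the Euclidean norm. Potential assumption (for fixed $\gamma>0$): there are constants $L,A\in(0,\infty)$ and $\lambda\in(0,1/4]$ such that $U\in C^1(\mathbb{R}^d)$, $U\ge0$, $\nabla U$ is $L$-Lipschitz, and $\frac12q\cdot\nabla U(q)\ge\lambda(U(q)+\frac{\gamma^2}{4}|q|^2)-A$ for all $q$. Asymptotically linear gradient assumption: there are $C_{\mathrm{linear}}>0$, a symmetric positive definite matrix $Q_\infty\in\mathbb{R}^{d\times d}$ and a nonincreasing function $\varrho:[0,\infty)\to[0,\infty)$ with $\varrho(r)\to0$ as $r\to\infty$ such that $|\nabla U(q)-Q_\infty q|\le\varrho(|q|)|q|$ for $|q|\ge C_{\mathrm{linear}}$ (only the values of $\varrho$ on $[C_{\mathrm{linear}},\infty)$ matter). *)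

(* Defs.v *)
From HB Require Import structures.
From mathcomp Require Import all_boot all_order all_algebra.
From mathcomp Require Import all_classical all_reals all_analysis.
Set Implicit Arguments.
Unset Strict Implicit.
Unset Printing Implicit Defensive.
Import Order.TTheory GRing.Theory Num.Theory.
Import numFieldNormedType.Exports.
Local Open Scope classical_set_scope.
Local Open Scope ring_scope.

(* Points of R^d are column vectors.  The canonical norm `|q| on 'cV[R]_d is
   the sup norm, so the Euclidean structure is introduced explicitly; the
   canonical topology, differentiability and derivatives of the library do not
   depend on this choice of norm. *)
Definition dot (R : realType) (d : nat) (x y : 'cV[R]_d) : R :=
  \sum_(i < d) x i 0 * y i 0.

Definition enorm (R : realType) (d : nat) (x : 'cV[R]_d) : R :=
  Num.sqrt (dot x x).

Definition gradient (R : realType) (d : nat) (U : 'cV[R]_d -> R)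
    (q : 'cV[R]_d) : 'cV[R]_d :=
  \col_(i < d) 'D_(delta_mx i 0) U q.

Definition is_C1 (R : realType) (d : nat) (U : 'cV[R]_d -> R) : Prop :=
  (forall q, differentiable U q) /\ continuous (gradient U).

Definition gradient_lipschitz (R : realType) (d : nat) (U : 'cV[R]_d -> R)
    (L : R) : Prop :=
  forall p q, enorm (gradient U p - gradient U q) <= L * enorm (p - q).

Definition dissipative (R : realType) (d : nat) (gamma : R)
    (U : 'cV[R]_d -> R) (lambda A : R) : Prop :=
  forall q, lambda * (U q + gamma ^+ 2 / 4 * enorm q ^+ 2) - A
            <= 2^-1 * dot q (gradient U q).

Definition potential_assumption (R : realType) (d : nat) (gamma : R)
    (U : 'cV[R]_d -> R) : Prop :=
  exists L A lambda : R,
    (0 < L /\ 0 < A /\ 0 < lambda <= 1 / 4) /\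
    is_C1 U /\
    (forall q, 0 <= U q) /\
    gradient_lipschitz U L /\
    dissipative gamma U lambda A.

Definition sym_posdef (R : realType) (d : nat) (Q : 'M[R]_d) : Prop :=
  Q^T = Q /\ forall x : 'cV[R]_d, x != 0 -> 0 < dot x (Q *m x).

(* A function [0, oo) -> [0, oo) is encoded as a function R -> R whose values
   on the negative reals are irrelevant. *)
Definition asymptotically_linear_gradient (R : realType) (d : nat)
    (U : 'cV[R]_d -> R) (Qinf : 'M[R]_d) : Prop :=
  sym_posdef Qinf /\
  exists (C : R) (rho : R -> R),
    0 < C /\
    (forall r, 0 <= r -> 0 <= rho r) /\
    (forall r s, 0 <= r -> r <= s -> rho s <= rho r) /\
    rho r @[r --> +oo] --> (0 : R) /\
    (forall q, C <= enorm q ->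
       enorm (gradient U q - Qinf *m q) <= rho (enorm q) * enorm q).

Definition double_well (R : realType) (s : R) : R :=
  if 1 / 2 <= `|s| then 1 / 2 * (`|s| - 1) ^+ 2 else 1 / 4 - 1 / 2 * s ^+ 2.

Definition separable_double_well (R : realType) (d : nat) (q : 'cV[R]_d) : R :=
  \sum_(i < d) double_well (q i 0).

Definition A1 (R : realType) (gamma : R) : R :=
  (gamma ^+ 4 + 6 * gamma ^+ 2 + 16) /
  (4 * (gamma ^+ 4 + 10 * gamma ^+ 2 + 24)).

Definition rho_dw (R : realType) (d : nat) (r : R) : R := Num.sqrt d%:R / r.

(* Main.v *)
(* Every claim splits over the coordinates.  The scalar potential v has a
   1-Lipschitz derivative v' with |v'(s) - s| <= 1, and the Taylor bound
   |v(y) - v(x) - v'(x)(y - x)| <= (y - x)^2, valid across the gluing points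
   -1/2 and 1/2, shows that v' is indeed its derivative.  For dissipativity,
   v is nonnegative, so only lambda = 1/(4 + gamma^2) matters; the constant A1
   is the one for which the defect on |s| >= 1/2 is then a perfect square. *)
Require Import Defs.
From HB Require Import structures.
From mathcomp Require Import all_boot all_order all_algebra.
From mathcomp Require Import all_classical all_reals all_analysis.
From mathcomp Require Import ring lra.
Import Order.TTheory GRing.Theory Num.Theory.
Import numFieldNormedType.Exports.
Local Open Scope classical_set_scope.
Local Open Scope ring_scope.

(** * The scalar double well *)

Section scalar_potential.
Context {R : realType}.
Implicit Types (s x y gamma lambda : R).

Definition double_well' s : R :=
  if 1 / 2 <= s then s - 1 else if s <= - (1 / 2) then s + 1 else - s.

(** Splitting by the position of [s] instead of [|s|] matches the branches of [double_well'], so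
    that case analysis leaves polynomial goals. *)
Lemma double_wellE s :
  double_well s =
  if 1 / 2 <= s then 1 / 2 * (s - 1) ^+ 2
  else if s <= - (1 / 2) then 1 / 2 * (s + 1) ^+ 2 else 1 / 4 - 1 / 2 * s ^+ 2.
Proof.
rewrite /double_well; case: (ger0P s) => s0.
  by repeat (case: leP => ? //); lra.
by repeat (case: leP => ? //); try ring; lra.
Qed.

Lemma double_well_ge0 s : 0 <= double_well s.
Proof.
rewrite /double_well; case: (lerP (1 / 2) `|s|) => s2.
  by rewrite mulr_ge0 ?sqr_ge0// divr_ge0.
by rewrite -real_normK ?num_real//; have := normr_ge0 s; nra.
Qed.

Lemma double_well'_lipschitz x y :
  `|double_well' x - double_well' y| <= `|x - y|.
Proof.
rewrite ler_norml /double_well'.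
by case: (ger0P (x - y)) => ?; case: (leP (1 / 2) x) => ?;
  case: (leP x (- (1 / 2))) => ?; case: (leP (1 / 2) y) => ?;
  case: (leP y (- (1 / 2))) => ?; lra.
Qed.

Lemma double_well'_sub_id s : `|double_well' s - s| <= 1.
Proof.
rewrite ler_norml /double_well'.
by case: (leP (1 / 2) s) => ?; case: (leP s (- (1 / 2))) => ?; lra.
Qed.

(** For each pair of pieces this is a polynomial inequality. The sharp constant is 1/2, but any
    constant identifies the derivative. *)
Lemma double_well_taylor x y :
  `|double_well y - double_well x - double_well' x * (y - x)| <= (y - x) ^+ 2.
Proof.
have xy2 := sqr_ge0 (y - x); rewrite !double_wellE /double_well' ler_norml.
by case: (leP (1 / 2) x) => ?; case: (leP x (- (1 / 2))) => ?;
  case: (leP (1 / 2) y) => ?; case: (leP y (- (1 / 2))) => ?;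
  apply/andP; split; nra.
Qed.

(** The quadratic remainder keeps the difference quotient within [|h|] of [l]. The gluing points are
    thus covered without one-sided derivatives. *)
Lemma is_derive1_quadratic (f : R -> R) x l :
  (forall y, `|f y - f x - l * (y - x)| <= (y - x) ^+ 2) -> is_derive x 1 f l.
Proof.
move=> fxl.
suff fl : h^-1 *: ((f \o shift x) h%:A - f x) @[h --> 0^'] --> l.
  by constructor; [exact: cvgP fl|exact: cvg_lim fl].
apply/cvgrPdist_le => e e0; near=> h.
have h0 : h != 0 by near: h; exact: nbhs_dnbhs_neq.
have he : `|h| <= e by near: h; exact: dnbhs0_le.
have := fxl (h + x); rewrite addrK => fh.
rewrite /= [_%:A]mulr1 /GRing.scale/=.
have -> : l - h^-1 * (f (h + x) - f x) =
    - (h^-1 * (f (h + x) - f x - l * h)) by field.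
rewrite normrN normrM normfV ler_pdivrMl ?normr_gt0//.
rewrite (le_trans fh)// -real_normK ?num_real// expr2.
by rewrite ler_wpM2l.
Unshelve. all: by end_near. Qed.

Lemma is_derive_double_well s :
  is_derive s 1 (@double_well R) (double_well' s).
Proof. by apply: is_derive1_quadratic => y; exact: double_well_taylor. Qed.

Lemma A1_gt0 gamma : 0 < A1 gamma.
Proof.
have := sqr_ge0 gamma; rewrite /A1 (exprM gamma 2 2) => g0.
by rewrite divr_gt0//; nra.
Qed.

Lemma double_well_dissipative gamma lambda s :
  0 <= lambda <= 1 / (4 + gamma ^+ 2) ->
  lambda * (double_well s + gamma ^+ 2 / 4 * s ^+ 2) - A1 gamma
  <= 2^-1 * (s * double_well' s).
Proof.
(* Only the square of [gamma] matters; it becomes a nonnegative variable [g]. *)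
rewrite /A1 (exprM gamma 2 2); have := sqr_ge0 gamma.
move: (gamma ^+ 2) => g g0 /andP[l0 lg].
set W := double_well s + _.
have W0 : 0 <= W.
  by rewrite addr_ge0 ?double_well_ge0// mulr_ge0 ?sqr_ge0// divr_ge0.
(* Since [W] is nonnegative, the left side grows with [lambda], which leaves the extremal value
   [1 / (4 + g)]. *)
apply: (@le_trans _ _ (1 / (4 + g) * W - (g ^+ 2 + 6 * g + 16) /
  (4 * (g ^+ 2 + 10 * g + 24)))); first by rewrite lerB// ler_wpM2r.
have g4 : 4 + g != 0 by rewrite gt_eqF//; lra.
have g6 : 6 + g != 0 by rewrite gt_eqF//; lra.
have gE : g ^+ 2 + 10 * g + 24 = (4 + g) * (6 + g) by ring.
have gg0 : 0 < 4 * ((4 + g) * (6 + g)) by rewrite !mulr_gt0//; lra.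
(* Multiplying the defect by [4 * ((4 + g) * (6 + g))] clears every denominator. *)
rewrite gE -subr_ge0 -(pmulr_rge0 _ gg0) /W.
rewrite double_wellE /double_well'; case: (leP (1 / 2)) => s1;
  last case: (leP s) => s2.
- rewrite [leRHS](_ : _ = ((6 + g) * s - (2 + g)) ^+ 2) ?sqr_ge0//.
  by field; rewrite g4 g6.
- rewrite [leRHS](_ : _ = ((6 + g) * s + (2 + g)) ^+ 2) ?sqr_ge0//.
  by field; rewrite g4 g6.
(* On the middle piece the defect decreases in [s ^+ 2]; the square added here is its value at
   [|s| = 1 / 2], where it meets the outer squares. *)
- rewrite [leRHS](_ : _ = (6 + g) * (6 + 3 * g) * (1 / 4 - s ^+ 2)
      + ((g - 2) / 2) ^+ 2).
    by rewrite addr_ge0 ?sqr_ge0// !mulr_ge0//; nra.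
  by field; rewrite g4 g6.
Qed.

End scalar_potential.

(** * Euclidean norm and separable functions *)

Section euclidean.
Context {R : realType} {d : nat}.
Implicit Types (p q : 'cV[R]_d) (f : R -> R).

Lemma dot_ge0 q : 0 <= dot q q.
Proof. by rewrite sumr_ge0// => i _; rewrite -expr2 sqr_ge0. Qed.

Lemma sqr_enorm q : enorm q ^+ 2 = \sum_(i < d) q i 0 ^+ 2.
Proof.
by rewrite /enorm sqr_sqrtr ?dot_ge0//; apply: eq_bigr => i _; rewrite expr2.
Qed.

Lemma le_enorm p q :
  (forall i, `|p i 0| <= `|q i 0|) -> enorm p <= enorm q.
Proof.
move=> pq; rewrite /enorm ler_wsqrtr// ler_sum// => i _.
rewrite -!expr2 -real_normK ?num_real// -[leRHS]real_normK ?num_real//.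
by rewrite lerXn2r// nnegrE.
Qed.

(** The all-ones vector is what [gradient U q - q] is compared with through [le_enorm]; this is
    where the square root of [d] comes from. *)
Lemma enorm_const1 : enorm (const_mx 1 : 'cV[R]_d) = Num.sqrt d%:R.
Proof.
rewrite /enorm /dot; under eq_bigr do rewrite !mxE mulr1.
by rewrite sumr_const card_ord.
Qed.

Lemma sym_posdef1 : sym_posdef (1%:M : 'M[R]_d).
Proof.
split=> [|x x0]; first exact: trmx1.
rewrite mul1mx lt_neqAle dot_ge0 andbT eq_sym; apply: contra x0 => /eqP xx0.
apply/eqP/matrixP => i j; rewrite ord1 mxE; apply/eqP.
move/eqP: xx0; rewrite /dot psumr_eq0 => [|k _]; last by rewrite -expr2 sqr_ge0.
by move=> /allP/(_ i (mem_index_enum i)); rewrite mulf_eq0 orbb.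
Qed.

Lemma differentiable_separable f q : (forall s, derivable f s 1) ->
  differentiable (fun q : 'cV[R]_d => \sum_(i < d) f (q i 0)) q.
Proof.
move=> df; rewrite [X in differentiable X _](_ : _ =
  \sum_(i < d) (f \o fun q : 'cV[R]_d => q i 0)); last first.
  by apply/funext => x; rewrite fct_sumE.
apply: differentiable_sum => i; apply: differentiable_comp.
  exact: differentiable_coord.
exact/derivable1_diffP.
Qed.

(** Only summand [i] moves along [delta_mx i 0], so the difference quotients already coincide for
    every [h]. *)
Lemma gradient_separable f q :
  gradient (fun q : 'cV[R]_d => \sum_(i < d) f (q i 0)) q =
  \col_(i < d) 'D_1 f (q i 0).
Proof.
apply/matrixP => i j; rewrite !mxE /derive; congr (lim (_ @ 0^')).
apply/funext => h; congr (_ *: _) => /=.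
rewrite (bigD1 i)//= [X in _ - X](bigD1 i)//= !mxE !eqxx mulr1.
rewrite [X in _ + X - _](eq_bigr (fun k => f (q k 0))).
  by rewrite opprD addrACA subrr addr0 [_%:A]mulr1.
by move=> k ki; rewrite !mxE (negbTE ki) mulr0 add0r.
Qed.

Lemma continuous_col_map f : continuous f ->
  continuous (fun q : 'cV[R]_d => \col_(i < d) f (q i 0) : 'cV[R]_d).
Proof.
move=> cf q; apply/(@cvg_ballP _ _ _ _ (nbhs_filter q)) => e e0.
(* There are finitely many coordinates, so one neighbourhood serves them all. *)
have : nbhs q (fun p : 'cV[R]_d => forall i, ball (f (q i 0)) e (f (p i 0))).
  apply: (@filter_forall _ _ _ (nbhs (q : 'cV[R]_d)) (nbhs_filter _)) => i.
  apply: (@continuous_comp _ _ _ (fun p : 'cV[R]_d => p i 0) f q).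
  - exact: coord_continuous.
  - exact: cf.
  - exact: nbhsx_ballx.
by apply: filterS => p qp; split=> // i j; rewrite !mxE.
Qed.

End euclidean.

(** * The separable double well *)

Lemma gradient_double_well {R : realType} {d : nat} (q : 'cV[R]_d) :
  gradient (@separable_double_well R d) q = \col_i double_well' (q i 0).
Proof.
rewrite gradient_separable; apply/matrixP => i j; rewrite !mxE.
by case: (is_derive_double_well (q i 0)).
Qed.

Lemma cvg_rho_dw {R : realType} (d : nat) : rho_dw d r @[r --> +oo] --> (0 : R).
Proof.
rewrite -[X in _ --> X](mulr0 (Num.sqrt d%:R)).
apply: cvgM; first exact: cvg_cst.
apply/gtr0_cvgV0; last exact: cvg_id.
exact: nbhs_pinfty_gt.
Qed.

Theorem proposition5p1 (R : realType) (gamma : R) (d : nat)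
    (gamma_gt0 : 0 < gamma) (d_ge1 : (1 <= d)%N) :
  let U : 'cV[R]_d -> R := @separable_double_well R d in
  (is_C1 U /\ gradient_lipschitz U 1) /\
  (forall lambda : R, 0 < lambda <= 1 / (4 + gamma ^+ 2) ->
     dissipative gamma U lambda (d%:R * A1 gamma)) /\
  ((forall q : 'cV[R]_d, Num.sqrt d%:R <= enorm q ->
      enorm (gradient U q - q) <= rho_dw d (enorm q) * enorm q) /\
   rho_dw d r @[r --> +oo] --> (0 : R)) /\
  potential_assumption gamma U /\
  asymptotically_linear_gradient U 1%:M.
Proof.
move=> U.
have sqrtd_gt0 : 0 < Num.sqrt d%:R :> R by rewrite sqrtr_gt0 ltr0n.
have C1U : is_C1 U.
  split=> [q|].
    by apply: differentiable_separable => s; case: (is_derive_double_well s).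
  rewrite (_ : gradient U = fun q => \col_i double_well' (q i 0)); last first.
    by apply/funext => q; exact: gradient_double_well.
  apply: continuous_col_map => s; apply/cvgrPdist_lt => e e0; near=> t.
  by rewrite (le_lt_trans (double_well'_lipschitz _ _))//; near: t;
    exact: cvgr_dist_lt.
have lipU : gradient_lipschitz U 1.
  move=> p q; rewrite mul1r !gradient_double_well; apply: le_enorm => i.
  by rewrite !mxE double_well'_lipschitz.
have dissU (lambda : R) : 0 < lambda <= 1 / (4 + gamma ^+ 2) ->
    dissipative gamma U lambda (d%:R * A1 gamma).
  move=> /andP[l0 lg] q; rewrite sqr_enorm gradient_double_well /U.
  have -> : d%:R * A1 gamma = \sum_(i < d) A1 gamma.
    by rewrite sumr_const card_ord mulr_natl.
  rewrite /dot !mulr_sumr -big_split/= mulr_sumr -sumrB.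
  apply: ler_sum => i _; rewrite !mxE.
  by apply: double_well_dissipative; rewrite (ltW l0).
(* This bound is uniform in [q], and its right side is [rho_dw d r * r] for every nonzero [r]. *)
have gradU q : enorm (gradient U q - q) <= Num.sqrt d%:R.
  rewrite -enorm_const1 gradient_double_well; apply: le_enorm => i.
  by rewrite !mxE normr1 double_well'_sub_id.
split; [by []|split; [by []|split; [split|split]]].
- move=> q dq; rewrite /rho_dw divfK ?gradU// gt_eqF//.
  exact: lt_le_trans dq.
- exact: cvg_rho_dw.
- have g4 : 0 < 4 + gamma ^+ 2 by rewrite ltr_wpDr ?sqr_ge0.
  (* The largest admissible [lambda] is taken; it is at most 1/4 because [gamma ^+ 2] is
     nonnegative. *)
  exists 1, (d%:R * A1 gamma), (1 / (4 + gamma ^+ 2)).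
  split; [split; [by []|split]|split; [by []|split; [|split; [by []|]]]].
  + by rewrite mulr_gt0 ?A1_gt0 ?ltr0n.
  + rewrite divr_gt0//= !div1r lef_pV2 ?posrE//.
    by rewrite lerDl sqr_ge0.
  + by move=> q; apply: sumr_ge0 => i _; exact: double_well_ge0.
  + by apply: dissU; rewrite lexx divr_gt0.
- split; first exact: sym_posdef1.
  (* [rho_dw d] itself is not nonincreasing on [0, oo): [rho_dw d 0 = 0]. *)
  exists (Num.sqrt d%:R), (fun r => rho_dw d (Num.max r (Num.sqrt d%:R))).
  have max_gt0 (r : R) : 0 < Num.max r (Num.sqrt d%:R).
    by rewrite lt_max sqrtd_gt0 orbT.
  split=> //; split; [|split; [|split]].
  + by move=> r _; rewrite /rho_dw divr_ge0// ltW.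
  + move=> r s _ rs; rewrite /rho_dw ler_wpM2l ?sqrtr_ge0//.
    by rewrite lef_pV2 ?posrE// ge_max !le_max rs lexx orbT.
  (* Beyond the square root of [d] the maximum is [r] itself, so the limit is unchanged. *)
  + apply: cvg_trans (cvg_rho_dw d); apply: near_eq_cvg; near=> r.
    by rewrite max_l//; near: r; exact: nbhs_pinfty_ge.
  + move=> q dq; rewrite max_l// mul1mx /rho_dw divfK ?gradU// gt_eqF//.
    exact: lt_le_trans dq.
Unshelve. all: by end_near. Qed.
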